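(* For each $k \in \mathbb{N}$, a graph $G$ is proportionally $(k,k)$-choosable if and only if $G$ is equitably $k$-colorable.
   Context: All graphs are nonempty, finite and simple. $\mathbb{N}=\{1,2,3,\ldots\}$ and $[m]=\{1,\ldots,m\}$. An equitable $k$-coloring of $G$ is a proper coloring $f:V(G)\to[k]$ such that the sizes of the $k$ color classes $f^{-1}(1),\ldots,f^{-1}(k)$ (possibly empty) differ pairwise by at most one; equivalently each class has size $\lceil |V(G)|/k\rceil$ or $\lfloor |V(G)|/k\rfloor$. $G$ is equitably $k$-colorable if it has an equitable $k$-coloring. For integers $1\le k\le \ell$, a $(k,\ell)$-assignment for a graph $G$ is a function $L$ assigning to each vertex $v$ of $G$ a set $L(v)\subseteq[\ell]$ with $|L(v)|=k$. Let $\mathcal{L}=\bigcup_{v\in V(G)}L(v)$ and, for $c\in\mathcal{L}$, let $\eta(c)=|\{v\in V(G): c\in L(v)\}|$. A proportional $L$-coloring of $G$ is a function $f$ on $V(G)$ with $f(v)\in L(v)$ for every $v$, with $f(u)\ne f(v)$ whenever $u,v$ are adjacent, and with $|f^{-1}(c)|\in\{\lfloor \eta(c)/k\rfloor,\lceil \eta(c)/k\rceil\}$ for every $c\in\mathcal{L}$. $G$ is proportionally $(k,\ell)$-choosable if a proportional $L$-coloring of $G$ exists for every $(k,\ell)$-assignment $L$ for $G$. *)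

(* Defs.v *)
From mathcomp Require Import all_boot.

Set Implicit Arguments.
Unset Strict Implicit.
Unset Printing Implicit Defensive.

Record graph := Graph {
  vertex :> finType;
  adj : rel vertex;
  adj_sym : symmetric adj;
  adj_irr : irreflexive adj;
  vertex_nonempty : 0 < #|vertex| }.

(* The color set [m] = {1, ..., m} is represented by 'I_m, with i : 'I_m
   standing for the color i + 1. *)

Definition proper_coloring (G : graph) (C : eqType) (f : G -> C) : Prop :=
  forall u v : G, adj u v -> f u != f v.

Definition color_class (G : graph) (m : nat) (f : G -> 'I_m) (c : 'I_m) :
    {set G} :=
  f @^-1: [set c].

Definition equitable_coloring (G : graph) (k : nat) (f : G -> 'I_k) : Prop :=
  proper_coloring f /\
  forall i j : 'I_k, #|color_class f i| <= #|color_class f j| + 1.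

Definition equitably_colorable (k : nat) (G : graph) : Prop :=
  exists f : G -> 'I_k, equitable_coloring f.

Definition assignment (G : graph) (k l : nat) (L : G -> {set 'I_l}) : Prop :=
  forall v : G, #|L v| = k.

Definition palette (G : graph) (l : nat) (L : G -> {set 'I_l}) : {set 'I_l} :=
  \bigcup_(v : G) L v.

Definition eta (G : graph) (l : nat) (L : G -> {set 'I_l}) (c : 'I_l) : nat :=
  #|[set v : G | c \in L v]|.

(* The ceiling of m / d, for d > 0. *)
Definition ceil_div (m d : nat) : nat := (m + d.-1) %/ d.

Definition proportional_coloring (G : graph) (k l : nat)
    (L : G -> {set 'I_l}) (f : G -> 'I_l) : Prop :=
  [/\ forall v : G, f v \in L v,
      proper_coloring f
    & forall c : 'I_l, c \in palette L ->
        #|color_class f c| = eta L c %/ k \/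
        #|color_class f c| = ceil_div (eta L c) k].

(* Meaningful only for 1 <= k <= l: for l < k there is no (k, l)-assignment
   and the property holds vacuously. *)
Definition proportionally_choosable (k l : nat) (G : graph) : Prop :=
  forall L : G -> {set 'I_l}, assignment k L ->
    exists f : G -> 'I_l, proportional_coloring k L f.

(* Main.v *)
Require Import Defs.
From mathcomp Require Import all_boot.
From mathcomp Require Import zify.

(** Every list of a (k, k)-assignment is the whole color set, so eta is constantly
    the number n of vertices. It remains to see that k numbers of sum n differ
    pairwise by at most one iff each of them is the floor or the ceiling of n / k. *)

Lemma ceil_div_bounds (n d : nat) :
  0 < d -> n %/ d <= ceil_div n d <= (n %/ d).+1.
Proof.
move=> d_gt0; rewrite leq_div2r ?leq_addr //= -ltnS ltn_divLR //.
have := ltn_ceil n d_gt0; nia.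
Qed.

(** The index [c] contributes no excess and each of the [k.-1] others at most one. This slack is
    exactly what rounding a quotient by [k] absorbs. *)
Lemma sum_leq_slack (k : nat) (s t : 'I_k -> nat) (c : 'I_k) :
  s c <= t c -> (forall i, s i <= t i + 1) ->
  \sum_i s i <= \sum_i t i + k.-1.
Proof.
move=> st_c st; rewrite (bigD1 c) // [X in _ <= X + _](bigD1 c) //= -addnA.
apply: leq_add => //.
have <- : \sum_(i | i != c) 1 = k.-1 by rewrite sum1_card cardC1 card_ord.
by rewrite -big_split /=; apply: leq_sum => i _.
Qed.

Lemma balanced_sumP (k : nat) (s : 'I_k -> nat) : 0 < k ->
  (forall i j, s i <= s j + 1) <->
  (forall c, s c = (\sum_i s i) %/ k \/ s c = ceil_div (\sum_i s i) k).
Proof.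
move=> k_gt0; set n := \sum_i s i.
have /andP[floor_le ceil_le] := ceil_div_bounds n k k_gt0.
split=> [bal c | s_val i j]; last by have := s_val i; have := s_val j; lia.
(* Comparing [s] with the constant family [s c], in both directions, puts [s c] between floor and
   ceiling, which are at most one apart. *)
have sum_const : \sum_(i < k) s c = k * s c by rewrite sum_nat_const card_ord.
have s_le : s c <= ceil_div n k.
  rewrite leq_divRL // mulnC -sum_const.
  exact: (sum_leq_slack _ (fun _ => s c) s c).
have s_ge : n %/ k <= s c.
  rewrite -ltnS ltn_divLR //.
  have := sum_leq_slack _ s (fun _ => s c) c (leqnn _) (bal ^~ c).
  by rewrite sum_const -/n; nia.
lia.
Qed.

Lemma sum_color_class (G : graph) (m : nat) (f : G -> 'I_m) :
  \sum_i #|color_class f i| = #|G|.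
Proof.
rewrite -sum1_card (partition_big f xpredT) //=; apply: eq_bigr => i _.
by rewrite -sum1_card; apply: eq_bigl => v; rewrite !inE.
Qed.

Lemma full_assignment (G : graph) (k : nat) (L : G -> {set 'I_k}) (v : G) :
  assignment k L -> L v = setT.
Proof.
by move=> kL; apply/eqP; rewrite eqEcard subsetT cardsT card_ord kL leqnn.
Qed.

Lemma proportional_full_assignment (G : graph) (k : nat) (L : G -> {set 'I_k})
    (f : G -> 'I_k) :
  0 < k -> assignment k L -> proportional_coloring k L f <-> equitable_coloring f.
Proof.
move=> k_gt0 kL; have LT v := full_assignment G k L v kL.
have etaE c : eta L c = #|G|.
  by rewrite /eta -cardsT; apply: eq_card => v; rewrite !inE LT inE.
(* A vertex is needed here: the size condition only concerns colors of the palette, while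
   equitability concerns all [k]. *)
have in_palette c : c \in palette L.
  have /card_gt0P[v _] := vertex_nonempty G.
  by apply/bigcupP; exists v; rewrite // LT inE.
(* The class sizes sum to [#|G|], the common value of [eta], so balance becomes the proportional
   size condition. *)
have := balanced_sumP k (fun i => #|color_class f i|) k_gt0.
rewrite sum_color_class /equitable_coloring => ->.
split=> [[_ f_proper f_size] | [f_proper f_size]]; split=> //.
- by move=> c; rewrite -(etaE c); apply: f_size.
- by move=> v; rewrite LT inE.
- by move=> c _; rewrite etaE.
Qed.

Theorem proposition5 (k : nat) (hk : 0 < k) (G : graph) :
  proportionally_choosable k k G <-> equitably_colorable k G.
Proof.
split=> [choosable | [f f_eq] L kL].
  have kT : assignment k (fun _ : G => [set: 'I_k]).
    by move=> v; rewrite cardsT card_ord.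
  by have [f /proportional_full_assignment-/(_ hk kT)] := choosable _ kT; exists f.
by exists f; apply/proportional_full_assignment.
Qed.
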